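(* Let $\Lambda$ be a left hereditary ring and $f:A\rightarrow B$ a homomorphism of $\Lambda$-modules. The following are equivalent: (1) $\underline{f}$ is an epimorphism in the stable category $\Lambda\text{-}\underline{\mathrm{Mod}}$; (2) for any representation $A=K\oplus P$ (as an internal direct sum of submodules) with $P$ projective, there exists a representation $B=M\oplus Q$ (as an internal direct sum of submodules) with $Q$ projective such that $f(K)\supset M$.
   Context: Rings are associative with identity; modules are left modules. The stable category $\Lambda\text{-}\underline{\mathrm{Mod}}$ has all left $\Lambda$-modules as objects; its morphisms are classes $\underline{f}$ of $\Lambda$-homomorphisms $f$, where $f$ and $g$ are equivalent if $f-g$ factors through a projective module. The symbol $\supset$ denotes non-strict containment. *)

(* Defs.v *)
From HB Require Import structures.
From mathcomp Require Import all_boot all_algebra.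
From mathcomp Require Import boolp.

Set Implicit Arguments.
Unset Strict Implicit.
Unset Printing Implicit Defensive.

Import GRing.Theory.
Local Open Scope ring_scope.
Local Open Scope quotient_scope.

(* [pzRingType] (associative rings with identity, possibly zero) is used rather
   than [nzRingType] because the zero ring is not excluded.  The modules
   [lmodType R] are left modules.  Carriers have boolean equality and choice,
   and submodules are boolean predicates; given the classical axioms of [boolp]
   neither is a restriction.  [submodClosed] asks for closure under 0, addition and
   scaling; over a ring this gives opposites through scaling by -1. *)

Definition projective (R : pzRingType) (P : lmodType R) : Prop :=
  forall (X Y : lmodType R) (p : {linear X -> Y}) (g : {linear P -> Y}),
    (forall y, exists x, p x = y) ->
    exists h : {linear P -> X}, forall z, p (h z) = g z.

Section Submodule.
Variables (R : pzRingType) (V : lmodType R) (S : submodClosed V).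

Definition submod : Type := {x : V | x \in S}.

HB.instance Definition _ := SubChoice.on submod.
HB.instance Definition _ := [SubChoice_isSubLmodule of submod by <:].

End Submodule.

Definition left_hereditary (R : pzRingType) : Prop :=
  forall I : submodClosed R^o, projective (submod I).

Definition internal_direct_sum (R : pzRingType) (V : lmodType R)
    (S T : submodClosed V) : Prop :=
  (forall x : V, exists2 s, s \in S & exists2 t, t \in T & x = s + t)
  /\ (forall x : V, x \in S -> x \in T -> x = 0).

Definition stable_eq (R : pzRingType) (A B : lmodType R)
    (f g : {linear A -> B}) : Prop :=
  exists P : lmodType R, projective P /\
  exists (u : {linear A -> P}) (v : {linear P -> B}),
    forall x, f x - g x = v (u x).

Lemma projective_zero (R : pzRingType) : projective ('rV[R]_0).
Proof.
move=> X Y p g _; exists (\0 : {linear 'rV[R]_0 -> X}) => z.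
by rewrite (thinmx0 z) !linear0.
Qed.

Lemma projective_prod (R : pzRingType) (P Q : lmodType R) :
  projective P -> projective Q -> projective (P * Q)%type.
Proof.
move=> hP hQ X Y p g psurj.
have lin1 : linear (fun x : P => g (x, 0)).
  by move=> a x y; rewrite -linearP; congr (g (_, _)); rewrite /= scaler0 addr0.
have lin2 : linear (fun x : Q => g (0, x)).
  by move=> a x y; rewrite -linearP; congr (g (_, _)); rewrite /= scaler0 addr0.
pose l1 := GRing.isLinear.Build _ _ _ _ _ lin1.
pose l2 := GRing.isLinear.Build _ _ _ _ _ lin2.
pose g1 : {linear P -> Y} := HB.pack (fun x : P => g (x, 0)) l1.
pose g2 : {linear Q -> Y} := HB.pack (fun x : Q => g (0, x)) l2.
have [h1 e1] := hP X Y p g1 psurj.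
have [h2 e2] := hQ X Y p g2 psurj.
exists ((h1 \o fst) \+ (h2 \o snd)) => -[x y] /=.
rewrite linearD e1 e2 /= -linearD; congr (g (_, _)) => /=.
  by rewrite addr0.
by rewrite add0r.
Qed.

Section StableEqTheory.
Variable R : pzRingType.
Implicit Types A B C D : lmodType R.

Lemma eq_stable_eq A B (f g : {linear A -> B}) : f =1 g -> stable_eq f g.
Proof.
move=> fg; exists 'rV[R]_0; split; first exact: projective_zero.
by exists \0, \0 => x; rewrite fg subrr.
Qed.

Lemma stable_eq_refl A B (f : {linear A -> B}) : stable_eq f f.
Proof. exact: eq_stable_eq. Qed.

Lemma stable_eq_sym A B (f g : {linear A -> B}) :
  stable_eq f g -> stable_eq g f.
Proof.
move=> [P [hP [u [v e]]]]; exists P; split=> //; exists u, (\- v) => x.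
by rewrite /= -e opprB.
Qed.

Lemma stable_eq_trans A B (f g h : {linear A -> B}) :
  stable_eq f g -> stable_eq g h -> stable_eq f h.
Proof.
move=> [P [hP [u [v e]]]] [Q [hQ [u' [v' e']]]].
exists (P * Q)%type; split; first exact: projective_prod.
have linu : linear (fun x => (u x, u' x)).
  by move=> a x y; rewrite !linearP.
pose l := GRing.isLinear.Build _ _ _ _ _ linu.
pose w : {linear A -> (P * Q)%type} := HB.pack (fun x => (u x, u' x)) l.
exists w, ((v \o fst) \+ (v' \o snd)) => x.
by rewrite /= -e -e' addrA subrK.
Qed.

Lemma stable_eq_comp A B C (f f' : {linear A -> B}) (g g' : {linear B -> C}) :
  stable_eq f f' -> stable_eq g g' -> stable_eq (g \o f) (g' \o f').
Proof.
move=> [P [hP [u [v e]]]] [Q [hQ [u' [v' e']]]].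
apply: (@stable_eq_trans _ _ _ (g \o f')).
  exists P; split=> //; exists u, (g \o v) => x.
  by rewrite /= -e linearB.
exists Q; split=> //; exists (u' \o f'), v' => x.
by rewrite /= -e'.
Qed.

End StableEqTheory.

Section StableCategory.
Variable R : pzRingType.
Implicit Types A B C D : lmodType R.

Section Hom.
Variables A B : lmodType R.

Definition stable_rel : rel {classic {linear A -> B}} :=
  fun f g => `[< stable_eq f g >].

Lemma stable_rel_equiv : equiv_class_of stable_rel.
Proof.
split=> [f|f g|f g h]; first exact/asboolP/stable_eq_refl.
  by apply: asbool_equiv_eq; split; exact: stable_eq_sym.
by move=> /asboolP gf /asboolP fh; apply/asboolP; exact: stable_eq_trans gf fh.
Qed.

Canonical stable_equiv := EquivRelPack stable_rel_equiv.

Definition stable_hom : Type := {eq_quot stable_equiv}.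

Definition stable_class (f : {linear A -> B}) : stable_hom :=
  \pi_({eq_quot stable_equiv}) (f : {classic {linear A -> B}}).

Definition stable_rep (u : stable_hom) : {linear A -> B} :=
  repr (u : {eq_quot stable_equiv}).

Lemma stable_repK (u : stable_hom) : stable_class (stable_rep u) = u.
Proof. exact: reprK. Qed.

Lemma stable_classP (f g : {linear A -> B}) :
  stable_class f = stable_class g <-> stable_eq f g.
Proof.
split=> [/eqmodP/asboolP//|fg]; exact/eqmodP/asboolP.
Qed.

End Hom.

Definition stable_id A : stable_hom A A := stable_class idfun.

Definition stable_comp A B C (v : stable_hom B C) (u : stable_hom A B) :
  stable_hom A C := stable_class (stable_rep v \o stable_rep u).

Lemma stable_compE A B C (g : {linear B -> C}) (f : {linear A -> B}) :
  stable_comp (stable_class g) (stable_class f) = stable_class (g \o f).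
Proof.
by apply/stable_classP/stable_eq_comp; apply/stable_classP/stable_repK.
Qed.

Lemma stable_comp1l A B (u : stable_hom A B) : stable_comp (stable_id B) u = u.
Proof.
rewrite -{1}[u]stable_repK stable_compE -[RHS]stable_repK.
exact/stable_classP/eq_stable_eq.
Qed.

Lemma stable_comp1r A B (u : stable_hom A B) : stable_comp u (stable_id A) = u.
Proof.
rewrite -{1}[u]stable_repK stable_compE -[RHS]stable_repK.
exact/stable_classP/eq_stable_eq.
Qed.

Lemma stable_compA A B C D (w : stable_hom C D) (v : stable_hom B C)
    (u : stable_hom A B) :
  stable_comp w (stable_comp v u) = stable_comp (stable_comp w v) u.
Proof.
rewrite -[w]stable_repK -[v]stable_repK -[u]stable_repK !stable_compE.
exact/stable_classP/eq_stable_eq.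
Qed.

Definition stable_epi A B (u : stable_hom A B) : Prop :=
  forall C (v w : stable_hom B C), stable_comp v u = stable_comp w u -> v = w.

End StableCategory.

(* Main.v *)
(* The kernel of any map from a module to a projective module is a direct summand
   with projective complement, because over a left hereditary ring submodules of
   projective modules are projective.  If f is a stable epimorphism and
   A = K (+) P, then the composite of f with g : B -> B / f(K) factors through P,
   so g factors through some u : B -> P' with P' projective; take M = ker u, which
   lies in ker g = f(K).  Conversely, if (g - g') f factors through u : A -> P',
   condition (2) for K = ker u gives B = M (+) Q with g - g' zero on M, so g - g'
   factors through Q. *)

Require Import Defs.
From HB Require Import structures.
From mathcomp Require Import all_boot all_algebra.
From mathcomp Require Import boolp classical_sets functions.
Set Implicit Arguments.
Unset Strict Implicit.
Unset Printing Implicit Defensive.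
Import GRing.Theory.
Local Open Scope ring_scope.
Local Open Scope quotient_scope.

(** * Linear maps, submodules and quotient modules built from bare functions and predicates *)

Lemma linear_ex (R : pzRingType) (V W : lmodType R) (f : V -> W) :
  linear f -> exists g : {linear V -> W}, g =1 f.
Proof.
move=> lin; pose l := GRing.isLinear.Build _ _ _ _ _ lin.
by exists (HB.pack_for {linear V -> W} f l).
Qed.

Lemma submod_ex (R : pzRingType) (V : lmodType R) (S : V -> Prop) :
  S 0 -> (forall a x y, S x -> S y -> S (a *: x + y)) ->
  exists K : submodClosed V, forall x, x \in K <-> S x.
Proof.
move=> S0 SL; pose p : V -> bool := fun x => `[< S x >].
have pcl : submod_closed p.
  split=> [|a x y /asboolP Sx /asboolP Sy]; apply/asboolP => //; exact: SL.
pose l := GRing.isSubmodClosed.Build _ _ p pcl.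
exists (HB.pack_for (submodClosed V) p l) => x; split=> [/asboolP//|Sx].
exact/asboolP.
Qed.

Lemma corestrict_ex (R : pzRingType) (V W : lmodType R) (S : submodClosed W)
    (f : {linear V -> W}) :
  (forall x, f x \in S) ->
  exists g : {linear V -> submod S}, forall x, val (g x) = f x.
Proof.
move=> fS.
have [|g gE] := @linear_ex R V (submod S) (fun x => Sub (f x) (fS x)).
  by move=> a x y; apply: val_inj; rewrite [RHS]linearP !SubK linearP.
by exists g => x; rewrite gE SubK.
Qed.

Lemma quotient_ex (R : pzRingType) (V : lmodType R) (S : submodClosed V) :
  exists (C : lmodType R) (g : {linear V -> C}), forall x, g x = 0 <-> x \in S.
Proof.
(* Only the additive structure of [S] is used to form the quotient group; the scalar action is then
   descended to it. *)
pose S' : V -> bool := fun x => x \in S.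
have S'zmod : zmod_closed S'.
  split=> [|x y Sx Sy]; first exact: rpred0.
  by apply: rpredD => //; rewrite -scaleN1r; exact: rpredZ.
pose Z : zmodClosed V :=
  HB.pack_for (zmodClosed V) S' (GRing.isZmodClosed.Build V S' S'zmod).
pose Q := Quotient.quot Z.
have piS (x y : V) : \pi_Q x = \pi_Q y <-> x - y \in S.
  by split=> [/eqP|xy]; last apply/eqP; rewrite -Quotient.idealrBE.
have pi_scale a (x y : V) : \pi_Q x = \pi_Q y -> \pi_Q (a *: x) = \pi_Q (a *: y).
  by move=> /piS xy; apply/piS; rewrite -scalerBr rpredZ.
have [scale scaleE] : exists scale : R -> Q -> Q,
    forall a x, scale a (\pi_Q x) = \pi_Q (a *: x).
  exists (fun a x => \pi_Q (a *: repr x)) => a x.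
  by apply: pi_scale; rewrite reprK.
have scaleA a b x : scale a (scale b x) = scale (a * b) x.
  by elim/quotW: x => x; rewrite !scaleE scalerA.
have scale1 : left_id 1 scale by elim/quotW=> x; rewrite scaleE scale1r.
have scaleDr : right_distributive scale +%R.
  move=> a; elim/quotW=> x; elim/quotW=> y.
  by rewrite -raddfD !scaleE -raddfD scalerDr.
have scaleDl x : {morph scale^~ x : a b / a + b}.
  by elim/quotW: x => x a b; rewrite !scaleE -raddfD scalerDl.
pose C : lmodType R := HB.pack_for (lmodType R) (Quotient.quot Z)
  (GRing.Zmodule_isLmodule.Build R Q scaleA scale1 scaleDr scaleDl).
have [a x y|g gE] := @linear_ex R V C (fun x => \pi_Q x).
  rewrite [LHS]raddfD; congr (_ + _); exact: (esym (scaleE a x)).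
exists C, g => x; rewrite gE -(raddf0 (\pi_Q)).
by rewrite piS subr0.
Qed.

(** * Embeddings into free modules, expressed by coordinates *)

Section Coordinates.
Variable R : pzRingType.

(** The [c i] are the components of an injective linear map into the direct sum of copies of [R]
    indexed by [I]; this encoding avoids constructing that sum. *)
Definition embeds_in_free (V : lmodType R) : Prop :=
  exists (I : eqType) (c : I -> {linear V -> R^o}),
    (forall x, exists s : seq I, forall i, c i x != 0 -> i \in s) /\
    (forall x, (forall i, c i x = 0) -> x = 0).

Lemma embeds_in_free_inj (V W : lmodType R) (j : {linear V -> W}) :
  injective j -> embeds_in_free W -> embeds_in_free V.
Proof.
move=> jI [I [c [cfin c0]]]; exists I, (fun i => c i \o j); split=> [x|x cx].
  exact: cfin.
by apply: jI; rewrite linear0; exact: c0.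
Qed.

End Coordinates.

(** * Lifting along a surjection, one coordinate at a time *)

Section PartialLift.
Variables (R : pzRingType) (hereditaryR : left_hereditary R).
Variables (V X Y : lmodType R) (p : {linear X -> Y}) (g : {linear V -> Y}).
Hypothesis p_surj : forall y, exists x, p x = y.
Variables (I : eqType) (c : I -> {linear V -> R^o}).
Hypothesis c_fin : forall x, exists s : seq I, forall i, c i x != 0 -> i \in s.
Hypothesis c_eq0 : forall x, (forall i, c i x = 0) -> x = 0.

Definition supported (J : set I) (x : V) : Prop := forall i, ~ J i -> c i x = 0.

Lemma supportedP J a x y :
  supported J x -> supported J y -> supported J (a *: x + y).
Proof. by move=> Jx Jy i iJ; rewrite linearP Jx // Jy // scaler0 addr0. Qed.

(** A partial lift is a total function whose values off the supported elements are arbitrary, so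
    that partial lifts with different domains share one type. *)
Definition lifts_on (J : set I) (h : V -> X) : Prop :=
  (forall a x y, supported J x -> supported J y ->
     h (a *: x + y) = a *: h x + h y) /\
  (forall x, supported J x -> p (h x) = g x).

(* The [i]-th coordinates of the elements supported on [J `|` [set i]] form a
   left ideal, so the projection onto it splits off the elements supported on
   [J]. *)
Lemma lifts_on_setU1 J i h : lifts_on J h -> ~ J i ->
  exists h', lifts_on (J `|` [set i]) h' /\
             forall x, supported J x -> h' x = h x.
Proof.
move=> [hlin hlift] nJi; set J' := (J `|` _)%classic.
have [|a x y|K KP] := @submod_ex R V (supported J').
- by move=> k _; rewrite linear0.
- exact: supportedP.
have [||L LP] := @submod_ex R R^o (fun r => exists2 x, x \in K & c i x = r).
- by exists 0; rewrite ?rpred0 ?linear0.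
- move=> a _ _ [x Kx <-] [y Ky <-]; exists (a *: x + y); last by rewrite linearP.
  by rewrite rpredD ?rpredZ.
have [|pr prE] := @corestrict_ex R (submod K) R^o L (c i \o val).
  by move=> x; apply/LP; exists (val x) => //; exact: valP.
(* The ideal [L] is projective, so its identity lifts to a section [s] of [pr]. Projectivity is used
   again for [k], which lifts [g] on the complement [s(L)]. *)
have [|s sK] := @hereditaryR L _ _ pr idfun.
  move=> r; have /LP[x Kx cx] := valP r; exists (Sub x Kx).
  by apply: val_inj; rewrite prE.
have [k kE] := @hereditaryR L _ _ p (g \o (val \o s)) p_surj.
(* The default 0 outside [K] only makes [e] total; [e] is linear on the elements supported on
   [J']. *)
pose e (x : V) : submod K := insubd (0 : submod K) x.
have eE x : supported J' x -> val (e x) = x by move=> /KP Kx; rewrite insubdK.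
have elin a x y : supported J' x -> supported J' y ->
    e (a *: x + y) = a *: e x + e y.
  move=> Jx Jy; apply: val_inj; rewrite [RHS]linearP /= !eE //; exact: supportedP.
(* Removing the [s(L)] component kills the [i]-th coordinate, so [r x] falls in the domain where [h]
   is already a lift. *)
pose r x := x - val (s (pr (e x))).
have rJ x : supported J' x -> supported J (r x).
  move=> J'x j nJj; rewrite /r linearB /=.
  have [->|ji] := eqVneq j i.
    have := congr1 val (sK (pr (e x))); rewrite !prE /= => ->.
    by rewrite eE // subrr.
  have nJ'j : ~ J' j by move=> [//|/= ij]; rewrite ij eqxx in ji.
  by rewrite J'x // (KP _).1 ?subr0 //; exact: valP.
exists (fun x => h (r x) + k (pr (e x))); split; first split.
- move=> a x y Jx Jy.
  have -> : r (a *: x + y) = a *: r x + r y.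
    by rewrite /r elin // !linearP /= addrACA scalerDr.
  rewrite hlin ?elin //; try exact: rJ.
  by rewrite !linearP /= scalerDr addrACA.
- move=> x Jx; rewrite linearD hlift ?kE; last exact: rJ.
  by rewrite /r linearB /= subrK.
move=> x Jx; have pr0 : pr (e x) = 0.
  apply: val_inj; rewrite prE /= eE ?linear0 ?Jx // => j J'j.
  by apply: Jx => Jj; apply: J'j; left.
by rewrite /r pr0 !linear0 !addr0.
Qed.

(* Zorn on pairs (J, h) with h a lift on the elements supported on J, ordered by
   extension: no well-ordering of the basis is needed. *)
Lemma lift_of_coordinates : exists h : {linear V -> X}, forall x, p (h x) = g x.
Proof.
pose T := {Jh : set I * (V -> X) | lifts_on Jh.1 Jh.2}.
pose ext (s t : T) := `[< ((sval s).1 `<=` (sval t).1)%classic /\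
  forall x, supported (sval s).1 x -> (sval t).2 x = (sval s).2 x >].
have supp0 x : supported set0 x -> x = 0 by move=> x0; apply: c_eq0 => i; exact: x0.
have lift0 : lifts_on set0 (fun=> 0).
  split=> [a x y _ _|x /supp0->]; first by rewrite scaler0 addr0.
  by rewrite !linear0.
pose t0 : T := exist _ (set0, fun=> 0) lift0.
have suppS (J J' : set I) x : (J `<=` J')%classic -> supported J x -> supported J' x.
  by move=> JJ' Jx i nJ'i; apply: Jx => Ji; exact/nJ'i/JJ'.
have [|r s t|A Atot|[[J h] /= [hlin hlift]] tmax] := @ZL_preorder T t0 ext.
- by move=> t; apply/asboolP; split.
- move=> /asboolP[rs rsE] /asboolP[st stE]; apply/asboolP; split=> [i ri|x rx].
    exact/st/rs.
  by rewrite stE ?rsE //; exact: suppS rx.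
- have [[t1 At1]|A0] := pselect (exists t, A t); last first.
    by exists t0 => s As; case: A0; exists s.
  pose J : set I := fun i => exists2 t, A t & (sval t).1 i.
  have directed s t : A s -> A t -> exists2 u, A u & ext s u /\ ext t u.
    move=> As At; have [st|ts] := Atot s t As At.
      by exists t => //; split=> //; apply/asboolP; split.
    by exists s => //; split=> //; apply/asboolP; split.
  (* Only finitely many coordinates of [x] are nonzero, so by directedness a single member of the
     chain already supports [x]. *)
  have cover x : supported J x -> exists2 t, A t & supported (sval t).1 x.
    move=> Jx; have [l lx] := c_fin x.
    suff [t At tl] : exists2 t, A t &
        forall i, i \in l -> c i x != 0 -> (sval t).1 i.
      exists t => // i nti; apply/eqP/negPn/negP => cix; exact/nti/tl/cix/lx.
    elim: l {lx} => [|i l [t At tl]]; first by exists t1.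
    have [cix|cix] := eqVneq (c i x) 0.
      by exists t => // j; rewrite inE => /orP[/eqP->|/tl//]; rewrite cix eqxx.
    have [t' At' t'i] : J i.
      by apply: contrapT => nJi; rewrite Jx ?eqxx in cix.
    have [u Au [/asboolP[tu _] /asboolP[t'u _]]] := directed t t' At At'.
    exists u => // j; rewrite inE => /orP[/eqP-> _|/tl tj cj]; first exact: t'u.
    exact/tu/tj.
  (* Members of the chain that support [x] agree there, having a common extension; 0 is the default
     when no member supports [x]. *)
  have agree x : exists y, forall t, A t -> supported (sval t).1 x -> (sval t).2 x = y.
    have [[t At tx]|no] := pselect (exists2 t, A t & supported (sval t).1 x).
      exists ((sval t).2 x) => t' At' t'x.
      have [u Au [/asboolP[_ tu] /asboolP[_ t'u]]] := directed t t' At At'.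
      by rewrite -tu // -t'u.
    by exists 0 => t At tx; case: no; exists t.
  have [h hE] := choice agree.
  have hJ : lifts_on J h.
    split=> [a x y /cover[t At tx] /cover[t' At' t'y]|x /cover[t At tx]].
      have [u Au [/asboolP[tu _] /asboolP[t'u _]]] := directed t t' At At'.
      have ux := suppS _ _ _ tu tx; have uy := suppS _ _ _ t'u t'y.
      rewrite -!(hE _ u) //; last exact: supportedP.
      exact: (svalP u).1.
    by rewrite -(hE _ t) //; exact: (svalP t).2.
  exists (exist _ (J, h) hJ) => s As; apply/asboolP; split=> [i si|x sx] /=.
    by exists s.
  by rewrite (hE _ s).
(* A missing index would allow a strict extension, against maximality. *)
have JT i : J i.
  apply: contrapT => nJi.
  have [h' [h'J h'h]] := lifts_on_setU1 (conj hlin hlift) nJi.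
  pose t' : T := exist _ ((J `|` [set i])%classic, h') h'J.
  have /tmax/asboolP[/= sub _] : ext (exist _ (J, h) (conj hlin hlift)) t'.
    by apply/asboolP; split=> //= j Jj; left.
  by apply/nJi/sub; right.
have suppT x : supported J x by move=> i /(_ (JT i)).
have [|H HE] := @linear_ex R V X h; first by move=> a x y; rewrite hlin.
by exists H => x; rewrite HE hlift.
Qed.

End PartialLift.

(** * Projective modules and submodules of free modules *)

Lemma projective_of_embedding (R : pzRingType) (V : lmodType R) :
  left_hereditary R -> embeds_in_free V -> projective V.
Proof.
move=> hR [I [c [c_fin c_eq0]]] X Y p g p_surj.
exact: (lift_of_coordinates hR g p_surj c_fin c_eq0).
Qed.

(** The free module [F] on the underlying set of [P] maps onto [P] by evaluating formal
    combinations. Projectivity splits this map, and the coordinates of the section embed [P]. *)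
Lemma projective_embeds (R : pzRingType) (P : lmodType R) :
  projective P -> embeds_in_free P.
Proof.
move=> projP; pose E := P -> R^o : lmodType R.
pose bounds (s : seq P) (x : E) := forall i, x i != 0 -> i \in s.
have boundsP s t a x y : bounds s x -> bounds t y -> bounds (s ++ t) (a *: x + y).
  move=> sx ty i; rewrite mem_cat; apply: contraR; rewrite negb_or => /andP[si ti].
  rewrite [_ i]/(a *: x i + y i).
  have /eqP-> : x i == 0 by apply: contraNT si; exact: sx.
  have /eqP-> : y i == 0 by apply: contraNT ti; exact: ty.
  rewrite scaler0; exact/eqP/addr0.
have [|a x y [s sx] [t ty]|F FP] := @submod_ex R E (fun x => exists s, bounds s x).
- by exists [::] => i; rewrite eqxx.
- by exists (s ++ t); exact: boundsP.
(* Evaluation does not depend on the list bounding the support: after zero coefficients are dropped,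
   both lists are permutations of the support. *)
have sum_bounds s t (x : E) : uniq s -> uniq t -> bounds s x -> bounds t x ->
    \sum_(i <- s) (x i : R) *: i = \sum_(i <- t) (x i : R) *: i.
  move=> us ut sx tx.
  have red r : \sum_(i <- r) (x i : R) *: i =
      \sum_(i <- [seq j <- r | x j != 0]) (x i : R) *: i.
    rewrite big_filter [LHS](bigID (fun i => x i != 0)) /= [X in _ + X]big1 ?addr0 //.
    by move=> i /negPn/eqP->; rewrite scale0r.
  rewrite red [RHS]red; apply: perm_big; apply: uniq_perm; rewrite ?filter_uniq //.
  move=> i; rewrite !mem_filter; case: eqVneq => //= xi.
  by rewrite sx // tx.
have ev_ex (x : submod F) : exists y : P, forall s, uniq s -> bounds s (val x) ->
    y = \sum_(i <- s) (val x i : R) *: i.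
  have /FP[s sx] := valP x.
  exists (\sum_(i <- undup s) (val x i : R) *: i) => t ut tx.
  by apply: sum_bounds; rewrite ?undup_uniq // => i /sx; rewrite mem_undup.
have [ev evE] := choice ev_ex.
have [a x y|p pE] := @linear_ex R (submod F) P ev.
  have /FP[s sx] := valP x; have /FP[t ty] := valP y.
  pose r := undup (s ++ t).
  have ur : uniq r by exact: undup_uniq.
  have rx : bounds r (val x) by move=> i /sx; rewrite mem_undup mem_cat => ->.
  have ry : bounds r (val y).
    by move=> i /ty; rewrite mem_undup mem_cat orbC => ->.
  have rxy : bounds r (val (a *: x + y)).
    move=> i; rewrite linearP => h.
    have := boundsP r r a _ _ rx ry i h; by rewrite mem_cat orbb.
  rewrite (evE _ r) // (evE _ r ur rx) (evE _ r ur ry).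
  rewrite scaler_sumr -big_split; apply: eq_bigr => i _ /=.
  by rewrite scalerA -scalerDl.
have p_surj z : exists x, p x = z.
  (* The basis vector at [z], which evaluates to [z]. *)
  pose d : E := fun i => if i == z then 1 else 0.
  have dz : bounds [:: z] d by move=> i; rewrite /d inE; case: (i == z); rewrite ?eqxx.
  have dF : d \in F by apply/FP; exists [:: z].
  exists (Sub d dF); rewrite pE (evE _ [:: z]) ?SubK //.
  by rewrite big_seq1 /d eqxx scale1r.
have [j jK] := projP _ _ p idfun p_surj.
have coord_ex (i : P) : exists c : {linear P -> R^o}, forall z, c z = val (j z) i.
  have [a x y|c cE] := @linear_ex R P R^o (fun z => val (j z) i).
    by rewrite !linearP.
  by exists c.
have [c cE] := choice coord_ex.
exists P, c; split=> [z|z cz].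
  have /FP[s sz] := valP (j z); exists s => i; rewrite cE; exact: sz.
have jz : j z = 0 by apply: val_inj; apply/funext => i; rewrite -cE cz.
by rewrite -[z]jK jz linear0.
Qed.

(** * Splitting off kernels, and projections of a direct sum *)

Lemma kernel_summand (R : pzRingType) (A P : lmodType R) (u : {linear A -> P}) :
  left_hereditary R -> projective P ->
  exists K Q : submodClosed A,
    [/\ internal_direct_sum K Q, projective (submod Q) &
        forall x, x \in K <-> u x = 0].
Proof.
move=> hR /projective_embeds embP.
have [||L LP] := @submod_ex R P (fun y => exists x, u x = y).
- by exists 0; rewrite linear0.
- by move=> a _ _ [x <-] [y <-]; exists (a *: x + y); rewrite linearP.
have embL : embeds_in_free (submod L).
  exact: (@embeds_in_free_inj _ _ _ val val_inj).
have [|v vE] := @corestrict_ex R A P L u; first by move=> x; apply/LP; exists x.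
have [y|s sK] := @projective_of_embedding _ _ hR embL _ _ v idfun.
  by have /LP[x xy] := valP y; exists x; apply: val_inj; rewrite vE.
have v0 x : v x = 0 <-> u x = 0.
  rewrite -vE; split=> [->|vx]; first by rewrite linear0.
  by apply: val_inj; rewrite vx linear0.
have [||K KP] := @submod_ex R A (fun x => u x = 0).
- exact: linear0.
- by move=> a x y ux uy; rewrite linearP ux uy scaler0 addr0.
(* The fixed points of the idempotent [s \o v] form the image of [s], a complement of the kernel;
   [v] is injective on them, so [Q] embeds wherever [L] does. *)
have [||Q QP] := @submod_ex R A (fun x => s (v x) = x).
- by rewrite !linear0.
- by move=> a x y sx sy; rewrite !linearP sx sy.
exists K, Q; split=> //; first split.
- move=> x; exists (x - s (v x)).
    by apply/KP/v0; rewrite linearB sK subrr.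
  by exists (s (v x)); [apply/QP; rewrite sK | rewrite subrK].
- by move=> x /KP/v0 vx /QP <-; rewrite vx linear0.
apply: projective_of_embedding => //.
apply: (@embeds_in_free_inj _ _ _ (v \o val)) embL => x y /= vxy.
apply: val_inj; have sv (z : submod Q) : s (v (val z)) = val z by exact/QP/valP.
by rewrite -sv vxy sv.
Qed.

Lemma direct_sum_projections (R : pzRingType) (V : lmodType R)
    (S T : submodClosed V) :
  internal_direct_sum S T ->
  exists (p : {linear V -> submod S}) (q : {linear V -> submod T}),
    forall x, x = val (p x) + val (q x).
Proof.
move=> [dec disj].
have decomp x : exists st : submod S * submod T, x = val st.1 + val st.2.
  have [s Ss [t Tt ->]] := dec x.
  by exists (Sub s Ss, Sub t Tt); rewrite !SubK.
have [d dE] := choice decomp.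
have uni (s s' : submod S) (t t' : submod T) :
    val s + val t = val s' + val t' -> s = s' /\ t = t'.
  move=> e; have e' : val (s - s') = val (t' - t).
    rewrite !linearB; apply: (addIr (val t)).
    by rewrite subrK addrAC e addrAC subrr add0r.
  have s0 : s - s' = 0.
    by apply: val_inj; rewrite linear0; apply: disj; [|rewrite e']; exact: valP.
  have t0 : t' - t = 0 by apply: val_inj; rewrite -e' s0 !linear0.
  by split; [apply/eqP; rewrite -subr_eq0 s0 | apply/esym/eqP; rewrite -subr_eq0 t0].
have dlin a x y : d (a *: x + y) = (a *: (d x).1 + (d y).1, a *: (d x).2 + (d y).2).
  have := dE (a *: x + y); rewrite {1}(dE x) {1}(dE y).
  rewrite scalerDr addrACA -!linearP => /uni[] -> ->.
  by case: (d _).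
have [|p pE] := @linear_ex R V (submod S) (fun x => (d x).1).
  by move=> a x y; rewrite dlin.
have [|q qE] := @linear_ex R V (submod T) (fun x => (d x).2).
  by move=> a x y; rewrite dlin.
by exists p, q => x; rewrite pE qE.
Qed.

(** * Stable epimorphisms in terms of direct sum decompositions *)

Theorem theorem5p10 (R : pzRingType) (hereditaryR : left_hereditary R)
    (A B : lmodType R) (f : {linear A -> B}) :
  stable_epi (stable_class f) <->
  (forall K P : submodClosed A,
     internal_direct_sum K P -> projective (submod P) ->
     exists M Q : submodClosed B,
       [/\ internal_direct_sum M Q,
           projective (submod Q) &
           forall y : B, y \in M -> exists2 x : A, x \in K & f x = y]).
Proof.
split=> [epi K P dsum projP|summand C v w].
- have [p [q pq]] := direct_sum_projections dsum.
  have [||L LP] := @submod_ex R B (fun y => exists2 x, x \in K & f x = y).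
  + by exists 0; rewrite ?rpred0 ?linear0.
  + move=> a _ _ [x Kx <-] [y Ky <-]; exists (a *: x + y); last by rewrite linearP.
    by rewrite rpredD ?rpredZ.
  have [C [g gL]] := quotient_ex L.
  have gf : stable_eq (g \o f) (\0 \o f).
    (* [g \o f] kills the [K] component of [x], since [f] sends it into [L]; only the [P] component
       given by [q] survives. *)
    exists (submod P); split=> //; exists q, (g \o (f \o val)) => x /=.
    rewrite subr0 {1}(pq x) !linearD (gL _).2 ?add0r //.
    by apply/LP; exists (val (p x)) => //; exact: valP.
  have /stable_classP[P' [projP' [u [v gE]]]] : stable_class g = stable_class \0.
    by apply: epi; rewrite !stable_compE; exact/stable_classP.
  have [M [Q [MQ projQ MP]]] := kernel_summand u hereditaryR projP'.
  exists M, Q; split=> // y /MP uy; apply/LP/gL.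
  by have := gE y; rewrite /= subr0 uy linear0.
rewrite -[v]stable_repK -[w]stable_repK !stable_compE.
move: (stable_rep v) (stable_rep w) => {v w} g g' /stable_classP.
move=> [P' [projP' [u [v vE]]]].
have [K [P [KP projP KE]]] := kernel_summand u hereditaryR projP'.
have [M [Q [MQ projQ MK]]] := summand K P KP projP.
have [p [q pq]] := direct_sum_projections MQ.
apply/stable_classP; exists (submod Q); split=> //.
exists q, ((g \- g') \o val) => y /=.
(* The [M] component of [y] is [f x] with [u x = 0], and there [vE] makes [g] and [g'] agree. *)
have [x /KE ux fx] := MK _ (valP (p y)).
have /= := vE x; rewrite ux linear0 fx => /eqP; rewrite subr_eq0 => /eqP gp.
by rewrite {1 2}(pq y) !linearD addrACA gp subrr add0r.
Qed.
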